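(* (Jacobi identity) Let $\mathbb{F}$ be a field of characteristic not $2$ and let $B$ be an invertible symmetric $3\times 3$ matrix over $\mathbb{F}$. For all vectors $v_1,v_2,v_3\in\mathbb{V}^3=\mathbb{F}^3$, $$\left\langle v_1,v_2,v_3\right\rangle_B+\left\langle v_2,v_3,v_1\right\rangle_B+\left\langle v_3,v_1,v_2\right\rangle_B=\mathbf{0}.$$
   Context: $\mathbb{V}^3$ is the space of row vectors $(x,y,z)$ over $\mathbb{F}$. The Euclidean vector product is $(x_1,y_1,z_1)\times(x_2,y_2,z_2)=(y_1z_2-y_2z_1,\;x_2z_1-x_1z_2,\;x_1y_2-x_2y_1)$. The $B$-vector product is $v\times_B w=(v\times w)\,\mathrm{adj}\,B$ (row vector times matrix), where $\mathrm{adj}\,B=(\det B)B^{-1}$ is the adjugate of $B$. The $B$-vector triple product is $\langle v_1,v_2,v_3\rangle_B=v_1\times_B(v_2\times_B v_3)$. *)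

(* Defs.v *)
From mathcomp Require Import all_boot all_order all_algebra.

Set Implicit Arguments.
Unset Strict Implicit.
Unset Printing Implicit Defensive.

Import GRing.Theory.
Local Open Scope ring_scope.

Definition crossv (F : fieldType) (v w : 'rV[F]_3) : 'rV[F]_3 :=
  let x1 := v 0 0 in let y1 := v 0 1 in let z1 := v 0 2%:R in
  let x2 := w 0 0 in let y2 := w 0 1 in let z2 := w 0 2%:R in
  \row_(j < 3) [:: y1 * z2 - y2 * z1; x2 * z1 - x1 * z2; x1 * y2 - x2 * y1]`_j.

(* [\adj B] is the transposed cofactor matrix, defined for every [B]; for an
   invertible [B] it is [(\det B) B^-1], see [adj_detV]. *)
Definition Bcross (F : fieldType) (B : 'M[F]_3) (v w : 'rV[F]_3) : 'rV[F]_3 :=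
  crossv v w *m \adj B.

Definition Btriple (F : fieldType) (B : 'M[F]_3) (v1 v2 v3 : 'rV[F]_3)
    : 'rV[F]_3 :=
  Bcross B v1 (Bcross B v2 v3).

Lemma adj_detV (F : fieldType) (B : 'M[F]_3) :
  B \in unitmx -> \adj B = \det B *: invmx B.
Proof.
move=> uB; rewrite /invmx uB scalerA divrr ?scale1r //.
Qed.

(* Main.v *)
Require Import Defs.
From mathcomp Require Import all_boot all_order all_algebra.
From mathcomp Require Import ring.

Import GRing.Theory.
Local Open Scope ring_scope.

(** Write [A] for [\adj B], which is symmetric because [B] is.  The vector
    product [v × w] only sees the antisymmetric part of the 3 × 3 matrix
    [v^T *m w] ([crossv_axial]), and this makes the cyclic sum in the Jacobi
    identity equal to [a *m A], where [a] is the axial vector of the matrix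
    [(v1^T *m (v2 × v3) + v2^T *m (v3 × v1) + v3^T *m (v1 × v2)) *m A].
    By Cramer's rule for the matrix with rows [v1], [v2], [v3], whose cofactor
    rows are the three vector products, the factor in front of [A] is a scalar
    matrix ([sum_outer_crossv]).  So the whole matrix is a multiple of [A],
    hence symmetric, and [a] vanishes. *)

(** Unlike a case analysis on the underlying number, this leaves the indices in
    the form [0], [1], [2%:R] in which [crossv] reads the coordinates. *)
Lemma ord3_ind (P : 'I_3 -> Prop) : P 0 -> P 1 -> P 2%:R -> forall i, P i.
Proof.
move=> P0 P1 P2 [[|[|[|//]]] lt_i3].
- by rewrite (_ : Ordinal _ = 0) //; apply: val_inj.
- by rewrite (_ : Ordinal _ = 1) //; apply: val_inj.
- by rewrite (_ : Ordinal _ = 2%:R) //; apply: val_inj.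
Qed.

Lemma sum_ord3 (V : nmodType) (f : 'I_3 -> V) :
  \sum_(i < 3) f i = f 0 + f 1 + f 2%:R.
Proof.
rewrite !big_ord_recl big_ord0 addr0 addrA.
by congr (_ + f _ + f _); apply: val_inj.
Qed.

(** The vector that encodes the antisymmetric matrix [M - M^T]. *)
Definition axial {F : fieldType} (M : 'M[F]_3) : 'rV[F]_3 :=
  \row_(j < 3) [:: M 1 2%:R - M 2%:R 1; M 2%:R 0 - M 0 2%:R; M 0 1 - M 1 0]`_j.

Lemma axialD (F : fieldType) (M N : 'M[F]_3) :
  axial (M + N) = axial M + axial N.
Proof.
by apply/rowP; elim/ord3_ind; rewrite !mxE /=; ring.
Qed.

Lemma axial_sym (F : fieldType) (M : 'M[F]_3) : M^T = M -> axial M = 0.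
Proof.
move=> symM; have symE i j : M i j = M j i by rewrite -[in LHS]symM mxE.
apply/rowP; elim/ord3_ind; rewrite !mxE /=.
- by rewrite (symE 1) subrr.
- by rewrite (symE 0) subrr.
- by rewrite (symE 0) subrr.
Qed.

Lemma crossv_axial (F : fieldType) (v w : 'rV[F]_3) :
  crossv v w = axial (v^T *m w).
Proof.
by apply/rowP; elim/ord3_ind; rewrite !(mxE, big_ord1) /=; ring.
Qed.

(** Cramer's rule [\adj M *m M = (\det M)%:M], transposed, for the matrix [M]
    with rows [u], [v], [w]: the scalar is the triple product [u . (v × w)],
    which is [\det M] expanded along its first row. *)
Lemma sum_outer_crossv (F : fieldType) (u v w : 'rV[F]_3) :
  u^T *m crossv v w + v^T *m crossv w u + w^T *m crossv u v
  = ((u *m (crossv v w)^T) 0 0)%:M.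
Proof.
apply/matrixP; elim/ord3_ind; elim/ord3_ind;
  by rewrite !(mxE, sum_ord3, big_ord1) /=; ring.
Qed.

Theorem theorem6 (F : fieldType) (hF : 2%N \notin [pchar F])
    (B : 'M[F]_3) (hBunit : B \in unitmx) (hBsym : B^T = B)
    (v1 v2 v3 : 'rV[F]_3) :
  Btriple B v1 v2 v3 + Btriple B v2 v3 v1 + Btriple B v3 v1 v2 = 0.
Proof.
have adj_sym : (\adj B)^T = \adj B by rewrite trmx_adj hBsym.
rewrite /Btriple /Bcross !(crossv_axial _ _ (_ *m \adj B)) -!mulmxDl -!axialD.
rewrite !mulmxA -!mulmxDl sum_outer_crossv mul_scalar_mx axial_sym ?mul0mx //.
by rewrite linearZ /= adj_sym.
Qed.
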